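(* Say that a model $\mathfrak{M}=\langle W,\langle\mathcal{N}_i\rangle_{i\in I},V\rangle$ satisfies binary consistency iff for all $i\in I$, all $w\in W$ and all $X\subseteq W$: if $X\in\mathcal{N}_i(w)$, then $W\setminus X\notin\mathcal{N}_i(w)$. The logic of the class of all models that satisfy binary consistency is axiomatized by adding to $\mathbf{B}$ all instances, for all $i\in I$, of the schema (D$_i$): $\square_i\varphi\rightarrow\neg\square_i\neg\varphi$.
   Context: Fix a (finite or infinite) index set $I$ and a countable set $\mathfrak{P}$ of propositional variables. A group is a non-empty finite subset of $I$; $G,H,J$ always range over groups. Language: $\mathfrak{L}$ is generated from $\mathfrak{P}$ and the constants $\bot,\top$ by the classical connectives ($\bot,\neg,\vee$ primitive, the others and $\top$ defined as usual) and the unary modal operators $\square_G$, one for each group $G$. Write $\square_i$ for $\square_{\{i\}}$. Models: a model is $\mathfrak{M}=\langle W,\langle\mathcal{N}_i\rangle_{i\in I},V\rangle$ with $W\neq\emptyset$, $\mathcal{N}_i:W\to\wp(\wp(W))$ for each $i\in I$, and $V:\mathfrak{P}\to\wp(W)$. For a group $G=\{i_1,\ldots,i_n\}$, $\mathcal{N}_G(w)=\{X_{i_1}\cap\cdots\cap X_{i_n}\mid X_{i_j}\in\mathcal{N}_{i_j}(w)\text{ for each }j\}$. Truth at a world is defined as usual for variables and classical connectives, and $\mathfrak{M},w\models\square_G\varphi$ iff $\|\varphi\|^{\mathfrak{M}}\in\mathcal{N}_G(w)$, where $\|\varphi\|^{\mathfrak{M}}=\{w\in W\mid\mathfrak{M},w\models\varphi\}$.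 For a class of models, $\Gamma\Vdash\varphi$ means: at every world of every model in the class at which all members of $\Gamma$ are true, $\varphi$ is true. The base system $\mathbf{B}$ consists of any sound and complete axiomatization of classical propositional logic, all instances in $\mathfrak{L}$ of (B1) $(\square_G\varphi\wedge\square_H\psi)\rightarrow\square_{G\cup H}(\varphi\wedge\psi)$, where $G\cap H=\emptyset$; (B2) $\square_{G\cup H}\top\rightarrow\square_G\top$; (B3) $(\square_G\varphi\wedge\square_{G\cup H\cup J}\varphi)\rightarrow\square_{G\cup H}\varphi$; (B4) $(\square_G\varphi\wedge\square_H(\varphi\vee\psi))\rightarrow\square_{G\cup H}\varphi$; and the rules (RE) if $\varphi\vdash\psi$ and $\psi\vdash\varphi$, then $\square_G\varphi\vdash\square_G\psi$; (MP) if $\vdash\varphi$ and $\vdash\varphi\rightarrow\psi$, then $\vdash\psi$. Systems obtained by adding axioms keep both rules. A theorem of a system is a formula derivable from its axioms by the rules; $\Gamma\vdash\varphi$ iff there are $\psi_1,\ldots,\psi_n\in\Gamma$ ($n\ge 0$) such that $(\psi_1\wedge\cdots\wedge\psi_n)\rightarrow\varphi$ is a theorem. The logic of a class of models is axiomatized by a system if the system is sound and strongly complete for the class: for all $\Gamma\subseteq\mathfrak{L}$, $\varphi\in\mathfrak{L}$, $\Gamma\vdash\varphi$ iff $\Gamma\Vdash\varphi$ over the class. *)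

(* Defs.v *)
From Stdlib Require List.
From mathcomp Require Import all_boot finmap.
From mathcomp Require Import boolp classical_sets.

Set Implicit Arguments.
Unset Strict Implicit.
Unset Printing Implicit Defensive.

Local Open Scope fset_scope.
Local Open Scope classical_set_scope.

Section Language.
Variable I : choiceType.

Record group := Group { gset :> {fset I}; group_neq0 : gset != fset0 }.

Lemma group_single_subproof (i : I) : [fset i]%fset != fset0.
Proof. by apply/fset0Pn; exists i; rewrite fset11. Qed.

Definition group_single (i : I) : group := Group (group_single_subproof i).

Lemma group_union_subproof (G H : group) : (gset G `|` gset H)%fset != fset0.
Proof.
by have /fset0Pn[i iG] := group_neq0 G; apply/fset0Pn; exists i; rewrite inE iG.
Qed.

Definition group_union (G H : group) : group :=
  Group (group_union_subproof G H).

Variable P : countType.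

Inductive form :=
  | Var of P
  | Bot
  | Neg of form
  | Or of form & form
  | Box of group & form.

Definition Top := Neg Bot.
Definition And (f g : form) := Neg (Or (Neg f) (Neg g)).
Definition Imp (f g : form) := Or (Neg f) g.

(* The empty conjunction is [Top]; a nonempty one carries a trailing [Top]. *)
Definition Conj (s : seq form) : form := foldr And Top s.

End Language.

Arguments Var {I P}.
Arguments Bot {I P}.
Arguments Top {I P}.

Section Semantics.
Variables (I : choiceType) (P : countType).

Record model := Model {
  world : Type;
  world_neq0 : [set: world] !=set0;
  nbhd : I -> world -> set (set world);
  val_of : P -> set world
}.

(* Only the values of the family [X] on [G] matter. *)
Definition gnbhd (M : model) (G : group I) (w : world M) : set (set (world M)) :=
  [set Y | exists X : I -> set (world M),
     (forall i, i \in gset G -> nbhd i w (X i)) /\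
     Y = \bigcap_(i in [set` gset G]) X i].

Fixpoint sat (M : model) (w : world M) (f : form I P) : Prop :=
  match f with
  | Var p => val_of p w
  | Bot => False
  | Neg g => ~ sat w g
  | Or g h => sat w g \/ sat w h
  | Box G g => gnbhd G w [set v | sat v g]
  end.

(* A class of models is a plain predicate: [set model] would force the universe
   of worlds strictly below that of [set], ruling out sets of formulas as
   worlds. *)
Definition entails (C : model -> Prop) (Gamma : set (form I P)) (f : form I P) :=
  forall M : model, C M -> forall w : world M,
    (forall g, Gamma g -> sat w g) -> sat w f.

Definition binary_consistency (M : model) : Prop :=
  forall (i : I) (w : world M) (X : set (world M)),
    nbhd i w X -> ~ nbhd i w (~` X).

End Semantics.

Section Systems.
Variables (I : choiceType) (P : countType).
Local Notation form := (form I P).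
Implicit Types (f g : form) (G H J : group I) (A : set form).

(* Boolean evaluation in which variables and boxed formulas are atoms. *)
Fixpoint beval (v : form -> bool) (f : form) : bool :=
  match f with
  | Var _ | Box _ _ => v f
  | Bot => false
  | Neg g => ~~ beval v g
  | Or g h => beval v g || beval v h
  end.

Definition tautology (f : form) : Prop := forall v, beval v f.

(* The propositional base consists of all instances of tautologies, which
   together with modus ponens axiomatize classical propositional logic. *)
Inductive B_axiom : form -> Prop :=
  | AxB0 f : tautology f -> B_axiom f
  | AxB1 G H f g : [disjoint gset G & gset H]%fset ->
      B_axiom (Imp (And (Box G f) (Box H g)) (Box (group_union G H) (And f g)))
  | AxB2 G H : B_axiom (Imp (Box (group_union G H) Top) (Box G Top))
  | AxB3 G H J f :
      B_axiom (Imp (And (Box G f) (Box (group_union (group_union G H) J) f))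
                   (Box (group_union G H) f))
  | AxB4 G H f g :
      B_axiom (Imp (And (Box G f) (Box H (Or f g))) (Box (group_union G H) f)).

Inductive D_axiom : form -> Prop :=
  | AxD i f :
      D_axiom (Imp (Box (group_single i) f) (Neg (Box (group_single i) (Neg f)))).

(* (RE) is stated on theorems: [f |- g] for a single premise amounts, up to
   tautologies, to [Imp f g] being a theorem. *)
Inductive is_theorem (A : set form) : form -> Prop :=
  | thm_ax f : A f -> is_theorem A f
  | thm_RE G f g : is_theorem A (Imp f g) -> is_theorem A (Imp g f) ->
      is_theorem A (Imp (Box G f) (Box G g))
  | thm_MP f g : is_theorem A f -> is_theorem A (Imp f g) -> is_theorem A g.

Definition derives A (Gamma : set form) (f : form) : Prop :=
  exists s : seq form,
    (forall g, List.In g s -> Gamma g) /\ is_theorem A (Imp (Conj s) f).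

Definition axiomatizes A (C : model I P -> Prop) : Prop :=
  forall (Gamma : set form) (f : form),
    derives A Gamma f <-> entails C Gamma f.

End Systems.

(* Main.v *)
Require Import Defs.
From Stdlib Require List.
From mathcomp Require Import all_boot finmap boolp classical_sets.

(** Soundness is elementary set theory.  For completeness, let a world be a
    maximal consistent set [v] together with a selector [s], which picks from
    every pair [k = (G, f)] a member [s k] of [G].  Member [i] of [G] receives
    the share of [(G, f)]

      [share (G, f) i = { (v, s) | f \in v or s (G, f) <> i }],

    and [i] has this share as a neighborhood of those worlds whose first
    component contains [Box G f].  At each world some member of [G] is selected, so the shares of [(G, f)]
    intersect exactly in the truth set of [f] ([bigcap_share]), whereas those of
    a proper part of [G] do not constrain [v] once the selector points outside
    that part.

    The truth lemma needs the converse ([shares_box]): if shares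
    [share (k i) i], one for each [i] in [H], happen to intersect in the truth
    set of [f], then [Box H f] holds.  Call [i] full when every member of the
    group of [k i] is in [H] and uses the same pair [k i].  The truth set of [f]
    does not depend on the selector; choosing selectors suitably shows that [f]
    is equivalent to the conjunction of the formulas of the full pairs, and
    implies the formulas of all the others.  Let [F] be the set of full indices.
    [AxB1] merges the boxes of the full pairs into [Box F f]; [AxB4] then
    enlarges [F] to a group that includes all groups in use, hence [H]; [AxB3]
    comes down from there to [H] itself, which lies between the two.  The set
    [F] may be empty, in which case [f] is valid and [AxB2] replaces [AxB3];
    [xbox] treats both cases at once.

    Binary consistency is checked in the same way.  If [share k i] and
    [share l i] are complementary, then selecting [i] everywhere shows that the
    two formulas contradict each other, and avoiding [i] shows that a pair whose
    group is not [{i}] has a valid formula.  In either case both formulas are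
    boxed for [{i}] ([theory_Box_single]), against [AxD]. *)

Set Implicit Arguments.
Unset Strict Implicit.
Unset Printing Implicit Defensive.

Local Open Scope classical_set_scope.

(** * Groups *)

Section Groups.
Variable I : choiceType.
Implicit Types G H : group I.

Lemma group_inj G H : gset G = gset H -> G = H.
Proof.
case: G H => [G G0] [H H0] /= eqGH; case: _ / eqGH H0 => H0.
by rewrite (bool_irrelevance G0 H0).
Qed.

Lemma group_unionKr G H : (gset G `<=` gset H)%fset -> group_union G H = H.
Proof. by move=> sGH; apply: group_inj => /=; apply/fsetUidPr. Qed.

End Groups.

(** * Soundness *)

Section Soundness.
Variables (I : choiceType) (P : countType).
Implicit Types (M : model I P) (G H J : group I) (f g : form I P).

Lemma sat_And M (w : world M) f g : sat w (And f g) <-> sat w f /\ sat w g.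
Proof.
split=> [/= nfg|[wf wg] [|] //].
by split; apply: contrapT => nh; apply: nfg; [left|right].
Qed.

Lemma sat_Imp M (w : world M) f g : sat w (Imp f g) <-> (sat w f -> sat w g).
Proof.
split=> [[]//|fg /=].
by case: (pselect (sat w f)) => [/fg|]; [right|left].
Qed.

Lemma sat_Conj M (w : world M) s :
  (forall g, List.In g s -> sat w g) -> sat w (Conj s).
Proof.
elim: s => [_ /=|h s IHs ws]; first by case.
apply/sat_And; split; first by apply: ws; left.
by apply: IHs => g sg; apply: ws; right.
Qed.

(** Truth at [w] is itself a Boolean valuation of variables and boxed
    formulas. *)
Lemma tautology_sat M (w : world M) f : tautology f -> sat w f.
Proof.
pose v g := `[< sat w g >].
have vE g : beval v g = `[< sat w g >].
  elim: g => [p|||g IHg h IHh|G g _] //=; first by rewrite asboolF.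
    by move=> g ->; rewrite asbool_neg.
  by rewrite IHg IHh asbool_or.
by move/(_ v); rewrite vE => /asboolP.
Qed.

Lemma gnbhdP M G (w : world M) (U : set (world M)) :
  gnbhd G w U <-> exists X, (forall i, i \in gset G -> nbhd i w (X i)) /\
                    (forall v, U v <-> forall i, i \in gset G -> X i v).
Proof.
split=> -[X [NX UX]]; exists X; split=> //; first by rewrite UX.
by rewrite predeqE => v; rewrite UX; split=> Xv i /Xv.
Qed.

(** The common reason for [AxB1], [AxB3] and [AxB4]: neighborhoods over [G] are
    completed outside [G] by whatever is available over [H]. *)
Lemma gnbhd_glue M G H (w : world M) (X Y : I -> set (world M)) U :
    (forall i, i \in gset G -> nbhd i w (X i)) ->
    (forall i, i \in gset H -> nbhd i w (Y i)) ->
    (forall v, U v <-> (forall i, i \in gset G -> X i v) /\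
                       (forall i, i \in gset H -> i \notin gset G -> Y i v)) ->
  gnbhd (group_union G H) w U.
Proof.
move=> NX NY UE; apply/gnbhdP.
exists (fun i => if i \in gset G then X i else Y i); split=> [i|v].
  by rewrite inE; case: ifP => [/NX|_ /NY].
rewrite UE; split=> [[Xv Yv] i|Zv].
  by rewrite inE; case: ifPn => [/Xv|iG /= /Yv]; last exact.
split=> i iG; last move=> iNG; have := Zv i; rewrite inE iG ?orbT /=.
  by move/(_ isT).
by rewrite (negPf iNG); exact.
Qed.

Lemma B_axiom_sound M f : B_axiom f -> forall w : world M, sat w f.
Proof.
case=> {f} [f /tautology_sat //|G H f g dGH|G H|G H J f|G H f g] w;
  apply/sat_Imp; rewrite ?sat_And.
- case=> /gnbhdP[X [NX XE]] /gnbhdP[Y [NY YE]].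
  apply: (gnbhd_glue NX NY) => v.
  apply: iff_trans (sat_And v f g) _; rewrite [sat v f]XE [sat v g]YE.
  split=> -[Xv Yv]; split=> // i iH; first by move=> _; exact: Yv.
  apply: Yv => //; apply: contraL iH; exact: (fdisjointP dGH).
- move=> /gnbhdP[X [NX XE]]; apply/gnbhdP; exists X.
  split=> [i iG|v]; first by apply: NX; rewrite inE iG.
  by split=> [/XE Xv i iG|_ []]; apply: Xv; rewrite inE iG.
- case=> /gnbhdP[X [NX XE]] /gnbhdP[Y [NY YE]].
  apply: (gnbhd_glue NX (Y := Y)) => [i iH|v].
    by apply: NY; rewrite !inE iH orbT.
  split=> [fv|[/XE //]]; split=> [|i iH _]; first exact/XE.
  by move/YE: fv; apply; rewrite !inE iH orbT.
- case=> /gnbhdP[X [NX XE]] /gnbhdP[Y [NY YE]].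
  apply: (gnbhd_glue NX NY) => v.
  split=> [fv|[/XE //]]; split=> [|i iH _]; first exact/XE.
  by apply: (YE v).1 => //; left.
Qed.

Lemma gnbhd_single M (i : I) (w : world M) U :
  gnbhd (group_single i) w U <-> nbhd i w U.
Proof.
rewrite gnbhdP; split=> [[X [NX UX]]|NU].
  suff -> : U = X i by apply: NX; rewrite inE.
  rewrite predeqE => v; rewrite UX.
  by split=> [|Xv j /fset1P->//]; apply; rewrite inE.
exists (fun=> U); split=> [j /fset1P->//|v].
by split=> [//|]; apply; exact: (fset11 i).
Qed.

Lemma D_axiom_sound M f :
  binary_consistency M -> D_axiom f -> forall w : world M, sat w f.
Proof.
move=> cM [i {}f] w; apply/sat_Imp => /gnbhd_single wf /gnbhd_single.
exact: cM wf.
Qed.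

Lemma derives_sound (A : set (form I P)) (C : model I P -> Prop) Gamma f :
    (forall g, A g -> forall M, C M -> forall w : world M, sat w g) ->
  derives A Gamma f -> entails C Gamma f.
Proof.
move=> sA [s [sG th]] M CM w wG.
suff thM : forall w : world M, sat w (Imp (Conj s) f).
  by apply: (sat_Imp _ _ _).1 (thM w) _; apply: sat_Conj => g /sG; exact: wG.
elim: th => {s f w wG sG} [f Af w|G f g _ IHfg _ IHgf w|f g _ IHf _ IHfg w].
- exact: sA.
- apply/sat_Imp => /=.
  suff -> : [set v | sat v f] = [set v | sat v g] :> set (world M) by [].
  by rewrite predeqE => v; split; apply/sat_Imp.
- by have /sat_Imp := IHfg w; apply.
Qed.

End Soundness.

(** * Derivations and maximal consistent theories *)

Section Theories.
Variables (I : choiceType) (P : countType) (A : set (form I P)).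
Hypothesis BA : @B_axiom I P `<=` A.
Implicit Types (f g h : form I P) (Gamma Delta v : set (form I P)).

Lemma thm_taut f : tautology f -> is_theorem A f.
Proof. by move=> tf; apply: thm_ax; apply: BA; exact: AxB0. Qed.

Lemma beval_Conj u s : beval u (@Conj I P s) = all (beval u) s.
Proof. by elim: s => //= f s <-; rewrite negb_or !negbK. Qed.

Lemma derives_thm Gamma f : is_theorem A f -> derives A Gamma f.
Proof.
move=> thf; exists [::]; split=> //; apply: thm_MP thf _.
by apply: thm_taut => u /=; case: (beval u f).
Qed.

Lemma derives_mem Gamma f : Gamma f -> derives A Gamma f.
Proof.
move=> Gf; exists [:: f]; split=> [g [<-|[]]//|].
by apply: thm_taut => u /=; case: (beval u f).
Qed.

Lemma derives_MP Gamma f g :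
  derives A Gamma f -> derives A Gamma (Imp f g) -> derives A Gamma g.
Proof.
move=> [s [sG ths]] [t [tG tht]]; exists (s ++ t); split=> [h|].
  by rewrite List.in_app_iff => -[/sG|/tG].
apply: thm_MP tht _; apply: thm_MP ths _; apply: thm_taut => u /=.
rewrite !beval_Conj all_cat.
by do 2!case: (all _ _); case: (beval u f); case: (beval u g).
Qed.

Lemma derives_deduction Gamma f g :
  derives A (Gamma `|` [set f]) g -> derives A Gamma (Imp f g).
Proof.
move=> [s [sG]]; elim: s g sG => [|h s IHs] g sG th.
  apply: derives_thm; apply: thm_MP th _; apply: thm_taut => u /=.
  by case: (beval u f); case: (beval u g).
have {}IHs : derives A Gamma (Imp f (Imp h g)).
  apply: IHs => [k sk|]; first by apply: sG; right.
  apply: thm_MP th _; apply: thm_taut => u /=.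
  by case: (beval u h); case: (beval u (Conj s)); case: (beval u g).
case: (sG h (or_introl erefl)) => [/derives_mem Gh|fh].
  apply: derives_MP Gh _; apply: derives_MP IHs _; apply: derives_thm.
  apply: thm_taut => u /=.
  by case: (beval u h); case: (beval u f); case: (beval u g).
rewrite fh in IHs; apply: derives_MP IHs _; apply: derives_thm.
by apply: thm_taut => u /=; case: (beval u f); case: (beval u g).
Qed.

Lemma derives_set0 f : derives A set0 f -> is_theorem A f.
Proof.
move=> [[|h s] [sG th]]; last by case: (sG h (or_introl erefl)).
by apply: thm_MP th; apply: thm_taut.
Qed.

Definition maximal_theory v : Prop :=
  [/\ forall f, is_theorem A f -> v f,
      forall f g, v (Imp f g) -> v f -> v g &
      forall f, v (Neg f) <-> ~ v f].

(** The language may be uncountable, so the extension is obtained from Zorn's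
    lemma, applied to the sets [X] such that [Gamma] and [X] together do not
    derive [f].  Completeness is built in by maximality: whatever lies outside
    the extension implies [f] over it. *)
Lemma lindenbaum Gamma f : ~ derives A Gamma f ->
  exists v, [/\ maximal_theory v, Gamma `<=` v & ~ v f].
Proof.
move=> nGf.
pose avoids := [set X | ~ derives A (Gamma `|` X) f].
have [F Favoid totF|X [nXf maxX]] := @Zorn_bigcup _ avoids.
  (* A derivation uses finitely many premises, so one member of the chain
     contains all of those that are not in [Gamma]; [set0] serves when there
     are none, as the chain may be empty. *)
  move=> [s [sF th]].
  have : exists X, (X = set0 \/ F X) /\
      forall g, List.In g s -> (Gamma `|` X) g.
    elim: s sF {th} => [|g s IHs] sF; first by exists set0; split; [left|].
    have [|X [FX sX]] := IHs; first by move=> h sh; apply: sF; right.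
    have [Gg|[Y FY Yg]] := sF g (or_introl erefl).
      by exists X; split=> // h [<-|/sX //]; left.
    have [X0|{}FX] := FX.
      exists Y; split; first by right.
      by move=> h [<-|/sX]; [right | rewrite X0; case=> //; left].
    have [XY|YX] := totF X Y FX FY.
      exists Y; split; first by right.
      by move=> h [<-|/sX [|/XY]]; [right|left|right].
    exists X; split; first by right.
    by move=> h [<-|/sX //]; right; exact: YX.
  move=> [X [[X0|FX] sX]].
    by apply: nGf; exists s; split=> // g /sX; rewrite X0 setU0.
  by apply: (Favoid X FX); exists s.
pose v := Gamma `|` X.
have nvf : ~ derives A v f by [].
have vmax g : ~ v g -> derives A v (Imp g f).
  move=> nvg; apply: derives_deduction; apply: contrapT => nf.
  apply: (maxX (X `|` [set g])); last by rewrite /avoids /= setUA.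
  rewrite properEneq; split; last by left.
  by apply/eqP => XE; apply: nvg; right; rewrite XE; right.
have vder g : derives A v g -> v g.
  move=> vg; apply: contrapT => /vmax gf; apply: nvf.
  exact: derives_MP vg gf.
exists v; split; last by move=> /derives_mem.
  split=> [g /(derives_thm v)/vder //|g h gh vg|g].
    by apply: vder; apply: derives_MP (derives_mem vg) (derives_mem gh).
  split=> [ng vg|/vmax gf].
    apply: nvf; apply: derives_MP (derives_mem ng) _.
    apply: derives_MP (derives_mem vg) _; apply: derives_thm.
    by apply: thm_taut => u /=; case: (beval u g).
  apply: contrapT => /vmax ngf; apply: nvf; apply: derives_MP gf _.
  apply: derives_MP ngf _; apply: derives_thm.
  by apply: thm_taut => u /=; case: (beval u g); case: (beval u f).
by left.
Qed.

Lemma theory_taut v f : maximal_theory v -> tautology f -> v f.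
Proof. by case=> thv _ _ /thm_taut; exact: thv. Qed.

Lemma theory_Or v f g : maximal_theory v -> v (Or f g) <-> v f \/ v g.
Proof.
move=> mv; have [_ vMP vneg] := mv; split=> [fg|].
  case: (pselect (v f)) => [|/vneg nf]; first by left.
  right; apply: (vMP _ _ _ nf); apply: vMP fg.
  by apply: theory_taut => // u /=; case: (beval u f); case: (beval u g).
by case; apply: vMP; apply: theory_taut => // u /=;
  case: (beval u f); case: (beval u g).
Qed.

Lemma theory_And v f g : maximal_theory v -> v (And f g) <-> v f /\ v g.
Proof.
move=> mv; have [_ _ vneg] := mv.
rewrite vneg theory_Or// !vneg; split=> [nn|[vf vg] []//].
by split; apply: contrapT => nh; apply: nn; [left|right].
Qed.

Definition valid f := forall v, maximal_theory v -> v f.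

Lemma valid_Imp f g :
  (forall v, maximal_theory v -> v f -> v g) -> is_theorem A (Imp f g).
Proof.
move=> fg; apply: derives_set0; apply: contrapT => /lindenbaum[v [mv _]].
rewrite theory_Or//; have [_ _ ->] := mv => nfg.
by case: (pselect (v f)) => [/(fg v mv) vg|nf]; apply: nfg; [right|left].
Qed.

(** * Boxes in a maximal theory *)

Section Boxes.
Variables (w : set (form I P)) (mw : maximal_theory w).
Implicit Types (G H J : group I) (K L : {fset I}).

Lemma theory_Box_eq G f g : (forall v, maximal_theory v -> (v f <-> v g)) ->
  w (Box G f) -> w (Box G g).
Proof.
have [thw wMP _] := mw => fg; apply: wMP; apply: thw.
by apply: thm_RE; apply: valid_Imp => v mv; have [] := fg v mv.
Qed.

Lemma theory_axiom f g : B_axiom (Imp f g) -> w f -> w g.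
Proof. by have [thw wMP _] := mw => /BA/thm_ax/thw; exact: wMP. Qed.

(** Boxes over possibly empty groups.  An intersection over the empty group is
    the set of all worlds, so the box of the empty group stands for validity.
    With this reading [AxB1] and [AxB4] extend to the empty group, and
    so does [AxB3], whose new instances amount to [AxB2]. *)
Definition xbox K f :=
  (K = fset0 /\ valid f) \/ (exists2 G, gset G = K & w (Box G f)).

Lemma xbox_group G f : xbox (gset G) f <-> w (Box G f).
Proof.
split=> [[[G0]|[H /group_inj -> //]]|wGf]; last by right; exists G.
by have := group_neq0 G; rewrite G0 eqxx.
Qed.

Lemma xbox_eq K f g : (forall v, maximal_theory v -> (v f <-> v g)) ->
  xbox K f -> xbox K g.
Proof.
move=> fg [[-> vf]|[G GK wf]].
  by left; split=> // v mv; apply: (fg v mv).1 _; exact: vf.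
by right; exists G => //; exact: theory_Box_eq wf.
Qed.

Lemma xbox_And K L f g : [disjoint K & L]%fset ->
  xbox K f -> xbox L g -> xbox (K `|` L)%fset (And f g).
Proof.
move=> dKL [[-> vf]|[G GK wf]] Lg.
  rewrite fset0U; apply: xbox_eq Lg => v mv; rewrite theory_And//.
  by split=> [vg|[]//]; split=> //; exact: vf.
case: Lg dKL => [[-> vg] _|[H HL wg] dKL].
  rewrite fsetU0; right; exists G => //; apply: theory_Box_eq wf => v mv.
  by rewrite theory_And//; split=> [vf|[]//]; split=> //; exact: vg.
right; exists (group_union G H); rewrite /= ?GK ?HL//.
apply: theory_axiom (AxB1 f g _) _; first by rewrite GK HL.
exact/theory_And.
Qed.

Lemma xbox_absorb K L f g : (forall v, maximal_theory v -> v f -> v g) ->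
  xbox K f -> xbox L g -> xbox (K `|` L)%fset f.
Proof.
move=> fg [[-> vf]|[G GK wf]] Lg.
  rewrite fset0U; apply: xbox_eq Lg => v mv.
  by split=> _; [exact: vf|apply: fg => //; exact: vf].
case: Lg => [[-> _]|[H HL wg]]; first by rewrite fsetU0; right; exists G.
right; exists (group_union G H); rewrite /= ?GK ?HL//.
apply: theory_axiom (AxB4 G H f g) _; apply/theory_And => //; split=> //.
apply: theory_Box_eq wg => v mv; rewrite theory_Or//.
by split=> [|[/fg|]]; [right|exact|].
Qed.

Lemma xbox_convex K L1 L2 f : (K `<=` L1)%fset -> (L1 `<=` L2)%fset ->
  xbox K f -> xbox L2 f -> xbox L1 f.
Proof.
move=> sK sL Kf L2f.
have [L10|L1n] := eqVneq L1 fset0.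
  by move: sK; rewrite L10 fsubset0 => /eqP <-.
case: L2f sL => [[-> _]|[H <- wH] sL].
  by rewrite fsubset0 (negPf L1n).
pose G1 : group I := Defs.Group L1n; apply/(xbox_group G1).
have eqH : group_union G1 H = H by exact: group_unionKr.
case: Kf sK => [[_ vf] _|[G <- wG] sK].
  have fT v : maximal_theory v -> v f <-> v Top.
    by move=> mv; split=> _; [exact: theory_taut|exact: vf].
  apply: (theory_Box_eq (fun v mv => iff_sym (fT v mv))).
  by apply: theory_axiom (AxB2 _ G1 H) _; rewrite eqH; exact: theory_Box_eq wH.
have eqG : group_union G G1 = G1 by exact: group_unionKr.
rewrite -eqG; apply: theory_axiom (AxB3 G G1 H f) _.
by apply/theory_And => //; rewrite eqG eqH.
Qed.

End Boxes.

(** * The canonical model *)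

Definition key := (group I * form I P)%type.

Definition selector := {s : key -> I | forall k, s k \in gset k.1}.

(** A single selector can obey a preference [Q] at all pairs at once, wherever
    the group has a preferred member.  This is where the worlds above one
    maximal theory are told apart. *)
Lemma selector_exists (Q : key -> I -> Prop) : exists s : selector,
  forall k j, j \in gset k.1 -> Q k j -> Q k (sval s k).
Proof.
have /choice[s sP] : forall k : key, exists i,
    i \in gset k.1 /\ forall j, j \in gset k.1 -> Q k j -> Q k i.
  move=> k.
  case: (pselect (exists2 j, j \in gset k.1 & Q k j)) => [[j jk Qj]|nQ].
    by exists j.
  have /fset0Pn[i ik] := group_neq0 k.1.
  by exists i; split=> // j jk Qj; case: nQ; exists j.
by exists (exist _ s (fun k => (sP k).1)) => k; exact: (sP k).2.
Qed.

Definition canonical_world := ({v | maximal_theory v} * selector)%type.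

Definition share (k : key) (i : I) : set canonical_world :=
  [set x | sval x.1 k.2 \/ sval x.2 k <> i].

Definition canonical_nbhd (i : I) (x : canonical_world) :
    set (set canonical_world) :=
  [set X | exists k : key,
     [/\ i \in gset k.1, sval x.1 (Box k.1 k.2) & X = share k i]].

Lemma canonical_world_neq0 (x : canonical_world) :
  [set: canonical_world] !=set0.
Proof. by exists x. Qed.

Definition canonical_model (x0 : canonical_world) : model I P :=
  Model (canonical_world_neq0 x0) canonical_nbhd
    (fun p => [set x | sval x.1 (Var p)]).

(** The selector always picks some member of the group, and the share of that
    member is constrained by the formula. *)
Lemma bigcap_share (k : key) (x : canonical_world) :
  (forall i, i \in gset k.1 -> share k i x) <-> sval x.1 k.2.
Proof.
split=> [xk|xk i _]; last by left.
by have [//|] := xk _ (svalP x.2 k).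
Qed.

Section BoxFromShares.
Variables (w : set (form I P)) (mw : maximal_theory w).
Variables (H : group I) (k : I -> key) (f : form I P).
Hypothesis kH : forall i, i \in gset H -> i \in gset (k i).1.
Hypothesis wk : forall i, i \in gset H -> w (Box (k i).1 (k i).2).
Hypothesis kf : forall x : canonical_world,
  (forall i, i \in gset H -> share (k i) i x) <-> sval x.1 f.

Let full i := forall j, j \in gset (k i).1 -> j \in gset H /\ k j = k i.
Let F := [fset i in gset H | `[< full i >]]%fset.

Let conj_box (K : {fset I}) := exists2 g, xbox w K g &
  forall v, maximal_theory v -> v g <-> forall i, i \in K -> v (k i).2.

Let FP i : i \in F <-> i \in gset H /\ full i.
Proof. by rewrite !inE; split=> [/andP[? /asboolP]|[-> /asboolP]]. Qed.

(** Let the selector pick [i] at [k i]: the share of [i] then constrains the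
    theory. *)
Lemma shares_sub i v :
  i \in gset H -> maximal_theory v -> v f -> v (k i).2.
Proof.
move=> iH mv vf; have [s sP] := selector_exists (fun _ j => j = i).
have [//|] : share (k i) i (exist _ v mv, s) by exact: (kf _).2.
by rewrite /= (sP _ i) ?kH.
Qed.

(** Let the selector avoid, at each pair [l], the indices of [H] that use [l].
    This is possible except when all members of the group of [l] are such
    indices, which leaves only the full pairs as constraints. *)
Lemma shares_eq_full v :
  maximal_theory v -> v f <-> forall i, i \in F -> v (k i).2.
Proof.
move=> mv; split=> [vf i /FP[iH _]|vF]; first exact: shares_sub.
have [s sP] := selector_exists (fun l j => ~ (j \in gset H /\ k j = l)).
apply: ((kf (exist _ v mv, s)).1) => i iH.
case: (pselect (full i)) => [fi|nfi]; first by left; apply: vF; apply/FP.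
right=> /= si; apply: nfi => j jk; apply: contrapT => /(sP _ _ jk).
by rewrite si; apply.
Qed.

(** The groups [(k i).1] of full indices [i] are pairwise equal or disjoint:
    if [j] lies in two of them, both are [(k j).1].  Their boxes can therefore
    be merged one after the other with [AxB1]; the merged set [K] stays closed
    under these groups, so that a new one is disjoint from it. *)
Lemma full_conj_box : conj_box F.
Proof.
suff grow (s : seq I) : {subset s <= F} -> exists K,
    [/\ {subset K <= F}, {subset s <= K},
        forall i, i \in K -> {subset gset (k i).1 <= K} & conj_box K].
  have [//|K [KF FK _]] := grow (enum_fset F).
  suff -> : K = F by [].
  by apply/fsetP => i; apply/idP/idP; [exact: KF|exact: FK].
elim: s => [_|a s IHs sF].
  exists fset0; split=> //; exists Top => [|v mv].
    by left; split=> // v mv; exact: theory_taut.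
  by split=> // _; exact: theory_taut.
have [|K [KF sK Kc [g Kg gP]]] := IHs.
  by move=> i si; apply: sF; rewrite inE si orbT.
have [aK|aNK] := boolP (a \in K).
  by exists K; split=> // [i|]; [rewrite inE => /predU1P[->|/sK]|exists g].
have /FP[aH fa] : a \in F by apply: sF; rewrite mem_head.
exists (K `|` gset (k a).1)%fset; split.
- move=> i; rewrite inE => /orP[/KF//|/fa[iH ki]].
  by apply/FP; split=> //; rewrite /full ki.
- by move=> i; rewrite !inE => /predU1P[->|/sK ->//]; rewrite kH ?orbT.
- move=> i; rewrite inE => /orP[/Kc si j /si|/fa[_ ->] j]; rewrite inE => ->//.
  by rewrite orbT.
exists (And g (k a).2) => [|v mv].
  apply: xbox_And => //; last exact/xbox_group/wk.
  apply/fdisjointP => i iK; apply: contra aNK => /fa[_ ki].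
  by apply: (Kc i iK); rewrite ki kH.
rewrite theory_And// gP//; split=> [[vK va] i|vKa].
  by rewrite inE => /orP[/vK//|/fa[_ ->]].
split=> [i iK|]; apply: vKa; rewrite inE ?iK//.
by rewrite kH ?orbT.
Qed.

(** [F] is included in [H], and [H] in the union of [F] with all the groups
    [(k i).1]; the box of [f] holds at both ends. *)
Lemma shares_box : w (Box H f).
Proof.
have [g Fg gP] := full_conj_box.
have Ff : xbox w F f.
  by apply: xbox_eq Fg => // v mv; rewrite gP// shares_eq_full.
suff [L HL Lf] : exists2 L : {fset I}, (gset H `<=` L)%fset & xbox w L f.
  apply/xbox_group; apply: xbox_convex HL Ff Lf => //.
  by apply/fsubsetP => i /FP[].
have : {subset enum_fset (gset H) <= gset H} by [].
suff : forall s : seq I, {subset s <= gset H} ->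
    exists2 L : {fset I}, {subset s <= L} & xbox w L f.
  by move=> + sH => /(_ _ sH)[L sL Lf]; exists L => //; apply/fsubsetP.
elim=> [_|i s IHs sH]; first by exists F.
have iH : i \in gset H by apply: sH; rewrite mem_head.
have [|L sL Lf] := IHs; first by move=> j sj; apply: sH; rewrite inE sj orbT.
exists (L `|` gset (k i).1)%fset.
  by move=> j; rewrite !inE => /predU1P[->|/sL->//]; rewrite kH ?orbT.
apply: xbox_absorb Lf ((xbox_group _ _ _).2 (wk iH)) => //.
by move=> v mv; exact: shares_sub.
Qed.

End BoxFromShares.

Lemma truth_lemma (x0 x : canonical_world) f :
  @sat I P (canonical_model x0) x f <-> sval x.1 f.
Proof.
elim: f x => [p||f IHf|f IHf g IHg|G f IHf] x //=; have mx := svalP x.1.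
- split=> // x_bot; have [_ _ vneg] := mx.
  by have /vneg := theory_taut mx (f := Top) (fun=> isT); apply.
- by have [_ _ ->] := mx; rewrite IHf.
- by rewrite theory_Or// IHf IHg.
rewrite gnbhdP; split=> [[X [NX XE]]|xf].
  have /choice[k kP] : forall i, exists k : key, i \in gset G ->
      [/\ i \in gset k.1, sval x.1 (Box k.1 k.2) & X i = share k i].
    move=> i; have [/NX[k kP]|] := boolP (i \in gset G); first by exists k.
    by exists (G, f).
  apply: (@shares_box _ mx G k) => [i /kP[]//|i /kP[]//|y].
  rewrite -IHf [sat _ _]XE; split=> yX i iG; have := yX i iG;
    by have [_ _ ->] := kP i iG.
exists (share (G, f)); split=> [i iG|y]; first by exists (G, f).
by rewrite /mkset IHf (bigcap_share (G, f)).
Qed.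

(** If [G], the group of [k], is not [{i}], a selector that avoids [i] puts
    every theory in the share of [k], hence outside the share of [l]; so [l.2]
    is never true and [k.2] is valid.  Its box then descends from [G] to [{i}] by convexity between the
    empty group and [G]. *)
Lemma theory_Box_single w (mw : maximal_theory w) (i : I) (k l : key) :
    i \in gset k.1 -> w (Box k.1 k.2) ->
    (forall y : canonical_world, share l i y <-> ~ share k i y) ->
    (forall v, maximal_theory v -> v l.2 <-> ~ v k.2) ->
  w (Box (group_single i) k.2).
Proof.
move=> ik wk lkN lkn.
have [[j jk ji]|nj] := pselect (exists2 j, j \in gset k.1 & j <> i); last first.
  suff -> : group_single i = k.1 by [].
  apply: group_inj; apply/fsetP => j; rewrite inE; apply/eqP/idP => [-> //|jk].
  by apply: contrapT => ji; apply: nj; exists j.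
apply/xbox_group.
have si : (gset (group_single i) `<=` gset k.1)%fset by rewrite fsub1set.
apply: (xbox_convex mw _ si _ ((xbox_group _ _ _).2 wk)); first exact: fsub0set.
left; split=> // v mv; apply: contrapT => /(lkn v mv).2 vl.
have [s sP] := selector_exists (fun _ j => j <> i).
have /lkN : share l i (exist _ v mv, s) by left; exact: vl.
by apply; right; exact: (sP _ j).
Qed.

Lemma canonical_model_binary_consistency (x0 : canonical_world) :
  @D_axiom I P `<=` A -> binary_consistency (canonical_model x0).
Proof.
move=> DA i x X [k [ik xk ->]] [l [il xl XE]]; have mx := svalP x.1.
have lkN (y : canonical_world) : share l i y <-> ~ share k i y by rewrite -XE.
have lkn v : maximal_theory v -> v l.2 <-> ~ v k.2.
  move=> mv; have [s sP] := selector_exists (fun _ j => j = i).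
  have := lkN (exist _ v mv, s); rewrite /share /= !(sP _ i)//.
  by case=> lk kl; split=> [vl vk|nk]; [apply: lk; left|case: kl => // -[]].
have {}xk := theory_Box_single mx ik xk lkN lkn.
have {}xl : sval x.1 (Box (group_single i) l.2).
  apply: (theory_Box_single mx il xl (l := k)) => [y|v mv]; last rewrite lkn//.
    by rewrite lkN notK.
  by rewrite notK.
have [thx xMP xneg] := mx.
have /xneg : sval x.1 (Neg (Box (group_single i) (Neg k.2))).
  by apply: xMP xk; apply: thx; apply: thm_ax; apply: DA.
apply; apply: theory_Box_eq xl => // v mv; rewrite lkn//.
by have [_ _ ->] := mv.
Qed.

End Theories.

(** * Soundness and strong completeness *)

Theorem theorem5 (I : choiceType) (P : countType) :
  axiomatizes (@B_axiom I P `|` @D_axiom I P) (@binary_consistency I P).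
Proof.
set A := _ `|` _.
have BA : @B_axiom I P `<=` A by left.
have DA : @D_axiom I P `<=` A by right.
move=> Gamma f; split.
  apply: derives_sound => g [Bg|Dg] M cM w; first exact: B_axiom_sound.
  exact: D_axiom_sound.
move=> ent; apply: contrapT => /(lindenbaum BA)[v [mv Gv nvf]].
have [s _] := selector_exists (fun (_ : key I P) _ => True).
pose x0 : canonical_world A := (exist _ v mv, s).
apply: nvf; apply/(truth_lemma BA x0 x0); apply: ent.
  exact: canonical_model_binary_consistency.
by move=> g /Gv; rewrite (truth_lemma BA).
Qed.
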